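(* Let $\mathbb{K}$ be an infinite field, let $d\ge 1$ and $n\ge 2d$ be integers, let $\pi:\mathbb{K}^n\to\mathbb{K}^n$ be a permutation of the coordinates, represented by the $n\times n$ permutation matrix $\Pi$, and let $r_0:=\operatorname{rank}(I-\Pi)$. (i) Suppose $r_0\le d$. Then $\operatorname{USP}(\mathcal{C}(V),\pi)$ holds for $V$ generic $n \times d$ Toeplitz. (ii) Suppose $r_0>d$, and suppose that there exists an integer $t$ with $0\le t\le \frac d2$ such that $$r_t:=\operatorname{rank}\big((\Pi-J^t)_{t+1:n,\,1:n}\big)\le d-2t,$$ or that there exists an integer $t$ with $-\frac d2\le t<0$ such that $$r_t:=\operatorname{rank}\big((\Pi-(J^\top)^{-t})_{1:n+t,\,1:n}\big)\le d+2t.$$ Then, for such a $t$, $\operatorname{USP}(\mathcal{C}(V),\pi)$ holds for $V$ generic $n \times d$ Toeplitz if and only if $r_t=d-2|t|$; that is, there is a dense Zariski-open subset $\mathscr{U}$ of the space of $n\times d$ Toeplitz matrices over $\mathbb{K}$ such that for every $V\in\mathscr{U}$, $\operatorname{USP}(\mathcal{C}(V),\pi)$ holds if and only if $r_t=d-2|t|$.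
   Context: For a linear subspace $\mathcal{V}\subseteq\mathbb{K}^n$ and a coordinate permutation $\pi$ of $\mathbb{K}^n$, the Unlabeled Sensing Property $\operatorname{USP}(\mathcal{V},\pi)$ is the statement: for all $v_1,v_2\in\mathcal{V}$, if $v_1=\pi(v_2)$ then $v_1=v_2$. $\mathcal{C}(V)$ is the column-space of the matrix $V$. The matrix $\Pi$ satisfies $\Pi v=\pi(v)$ for all $v\in\mathbb{K}^n$, and $I$ is the $n\times n$ identity matrix. $J$ is the $n\times n$ lower-triangular Jordan block with eigenvalue zero (ones on the first subdiagonal, zeros elsewhere), $J^0=I$, and $J^\top$ is its transpose. For a matrix $M$, $M_{\alpha:\alpha',\,\beta:\beta'}$ is the submatrix of rows $\alpha,\dots,\alpha'$ and columns $\beta,\dots,\beta'$. A matrix is Toeplitz if its $(i,j)$ entry depends only on $i-j$. Let $\mathbb{T}_{n\times d}$ be the affine space of $n\times d$ Toeplitz matrices with entries in $\mathbb{K}$. A statement holds ''for $V$ generic Toeplitz'' if there is a dense Zariski-open subset $\mathscr{U}\subseteq\mathbb{T}_{n\times d}$ such that the statement holds for every $V\in\mathscr{U}$. *)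

(* Defs.v *)
From mathcomp Require Import all_boot all_order all_fingroup all_algebra.
From mathcomp Require Import mpoly.

Set Implicit Arguments.
Unset Strict Implicit.
Unset Printing Implicit Defensive.

Import GRing.Theory.
Local Open Scope ring_scope.

Definition infinite_type (T : eqType) : Prop :=
  forall s : seq T, exists x : T, x \notin s.

(* The coordinate permutation v |-> (v_(s i))_i. *)
Definition coord_perm (K : fieldType) (n : nat) (s : 'S_n) (v : 'cV[K]_n) :
  'cV[K]_n := row_perm s v.

(* [perm_mx s] is the matrix that represents [coord_perm s]. *)
Lemma mul_perm_mx_cV (K : fieldType) (n : nat) (s : 'S_n) (v : 'cV[K]_n) :
  perm_mx s *m v = coord_perm s v.
Proof. by rewrite /coord_perm row_permE. Qed.

Definition USP (K : fieldType) (n : nat) (W : {vspace 'cV[K]_n}) (s : 'S_n) :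
  Prop :=
  forall v1 v2 : 'cV[K]_n,
    v1 \in W -> v2 \in W -> v1 = coord_perm s v2 -> v1 = v2.

Definition colspace (K : fieldType) (n d : nat) (V : 'M[K]_(n, d)) :
  {vspace 'cV[K]_n} := <<[seq col j V | j : 'I_d]>>%VS.

Definition jordan0 (K : fieldType) (n : nat) : 'M[K]_n :=
  \matrix_(i, j) (nat_of_ord i == j.+1)%:R.

Lemma last_ord_proof (n k : nat) (i : 'I_(n - k)) : (k + i < n)%N.
Proof. by rewrite -ltn_subRL. Qed.

(* Embeddings onto the last and the first n - k indices of 'I_n. *)
Definition last_ord (n k : nat) (i : 'I_(n - k)) : 'I_n :=
  Ordinal (last_ord_proof i).
Definition first_ord (n k : nat) (i : 'I_(n - k)) : 'I_n :=
  widen_ord (leq_subr k n) i.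

(* [Negz k] is the integer - k.+1. *)
Definition shift_rank (K : fieldType) (n : nat) (s : 'S_n) (t : int) : nat :=
  match t with
  | Posz k =>
      \rank (rowsub (@last_ord n k) (perm_mx s - jordan0 K n ^+ k))
  | Negz k =>
      \rank (rowsub (@first_ord n k.+1)
               (perm_mx s - (jordan0 K n)^T ^+ k.+1))
  end.

Definition toeplitz (K : fieldType) (n d : nat) (V : 'M[K]_(n, d)) : Prop :=
  forall (i i' : 'I_n) (j j' : 'I_d),
    i%:Z - j%:Z = i'%:Z - j'%:Z -> V i j = V i' j'.

(* The Zariski topology of the space of Toeplitz matrices is the one induced
   by the Zariski topology of the affine space of all matrices, whose n * d
   coordinates are the entries: the open sets are the unions of the sets of
   Toeplitz matrices at which a given polynomial does not vanish. *)
Definition mx_eval (K : fieldType) (n d : nat) (p : {mpoly K[n * d]})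
  (V : 'M[K]_(n, d)) : K := p.@[fun k => mxvec V 0 k].

Definition toeplitz_open (K : fieldType) (n d : nat)
  (U : 'M[K]_(n, d) -> Prop) : Prop :=
  exists S : {mpoly K[n * d]} -> Prop,
    forall V, U V <-> toeplitz V /\ exists2 p, S p & mx_eval p V != 0.

Definition toeplitz_dense (K : fieldType) (n d : nat)
  (U : 'M[K]_(n, d) -> Prop) : Prop :=
  forall W : 'M[K]_(n, d) -> Prop,
    toeplitz_open W -> (exists V, W V) -> exists V, U V /\ W V.

Definition generic_toeplitz (K : fieldType) (n d : nat)
  (P : 'M[K]_(n, d) -> Prop) : Prop :=
  exists U : 'M[K]_(n, d) -> Prop,
    [/\ toeplitz_open U, toeplitz_dense U & forall V, U V -> P V].

(* Main.v *)
Require Import Defs.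
From mathcomp Require Import all_boot all_order all_fingroup all_algebra.
From mathcomp Require Import mpoly.
From mathcomp Require Import zify.

Set Implicit Arguments.
Unset Strict Implicit.
Unset Printing Implicit Defensive.

Import GRing.Theory.
Local Open Scope ring_scope.

(** A Toeplitz matrix V is determined by the sequence a of its diagonals. Let
    L be the linear functional on {poly K} with L('X^k) = a k. Reading a vector
    x backwards as a polynomial p of size at most d, the i-th coordinate of
    V *m x is L('X^i * p): the column space of V consists of the moment vectors
    of the polynomials p of size at most d, and a coincidence v1 = pi v2 in it
    is a system L('X^i * q) = L('X^(s i) * p), for i < n. In this language the
    Jordan block removes a factor 'X: row i >= t of J^t (V x) is
    L('X^(i - t) * p), which is row i of V y when p = q * 'X^t.

    Genericity enters only through [generic_moment_vec_inj]: if m + e = n + d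
    and B has m columns and rank at least e, then for generic V no nonzero p of
    size at most e has a moment vector of length m killed by B. What must
    be found is one sequence a such that B times the Hankel matrix of a has
    full column rank. Sums of geometric sequences provide it: their Hankel
    matrices factor into two Vandermonde matrices, and the possible columns of
    these span the whole space because K is infinite.

    Let Q be the matrix whose rank is r_t, with t >= 0.

    - [generic_USP_shift]: on its rows >= t, the coincidence says that Q maps
      the moment vector of p to the one of q * 'X^t - p, a polynomial of size at
      most d + t. As rank Q is small, the cokernel of Q is large enough to force
      p = q * 'X^t for generic V. For t = 0 this is p = q, hence part (i).

    - Suppose t > 0. What remains of the coincidence, once p = q * 'X^t, is a
      linear system of rank t + r_t [recurrence_mx] on the moment vector of
      length t + n of q, where q has size at most d - t. If r_t = d - 2 t, there
      are as many equations as unknowns, and generically q = 0: the property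
      holds. If r_t < d - 2 t, a nonzero q survives for every V, and p differs
      from q since t > 0: the property fails as soon as V is injective.

    A negative t for s is a positive one for the inverse of s [shift_rankN],
    and USP does not distinguish a permutation from its inverse. *)

(** * Generic Toeplitz matrices *)

Lemma mx_evalX (K : fieldType) (n d : nat) (V : 'M[K]_(n, d)) i j :
  mx_eval 'X_(mxvec_index i j) V = V i j.
Proof. by rewrite /mx_eval mevalXU mxvecE. Qed.

Lemma mx_evalM (K : fieldType) (n d : nat) (p q : {mpoly K[n * d]})
  (V : 'M[K]_(n, d)) : mx_eval (p * q) V = mx_eval p V * mx_eval q V.
Proof. by rewrite /mx_eval rmorphM. Qed.

(** This reduces the density of basic open sets to the finiteness of the set
    of roots of a univariate polynomial. *)
Lemma mx_eval_line (K : fieldType) (n d : nat) (p : {mpoly K[n * d]})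
    (V W : 'M[K]_(n, d)) :
  exists P : {poly K}, forall x, P.[x] = mx_eval p (V + x *: W).
Proof.
exists (\sum_(m <- msupp p) p@_m *:
  \prod_k ((mxvec V 0 k)%:P + mxvec W 0 k *: 'X) ^+ m k) => x.
rewrite /mx_eval mevalE horner_sum; apply: eq_bigr => m _.
rewrite hornerZ horner_prod; congr (_ * _); apply: eq_bigr => k _.
by rewrite horner_exp !hornerE linearD linearZ !mxE mulrC.
Qed.

Lemma infinite_uniq_seq (K : fieldType) (K_infinite : infinite_type K) m :
  exists2 s : seq K, uniq s & size s = m.
Proof.
elim: m => [|m [s us <-]]; first by exists [::].
by have [x xs] := K_infinite s; exists (x :: s); rewrite //= xs.
Qed.

Lemma infinite_nonroot (K : fieldType) (K_infinite : infinite_type K)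
  (p : {poly K}) : p != 0 -> exists x, p.[x] != 0.
Proof.
move=> p0; have [s us sz] := infinite_uniq_seq K_infinite (size p).
have /allPn[x _ xp] : ~~ all (root p) s.
  by apply/negP => rs; have := max_poly_roots p0 rs us; rewrite sz ltnn.
by exists x.
Qed.

Lemma toeplitz_line (K : fieldType) (n d : nat) (V W : 'M[K]_(n, d)) (x : K) :
  toeplitz V -> toeplitz W -> toeplitz (V + x *: W).
Proof.
by move=> tV tW i i' j j' ij; rewrite !mxE (tV _ _ _ _ ij) (tW _ _ _ _ ij).
Qed.

(** Irreducibility of the affine space of Toeplitz matrices: if p and q are
    nonzero at some points, then on the line through these points both
    restrict to nonzero univariate polynomials, and over an infinite field
    their product has a nonzero value. *)
Lemma generic_toeplitz_nonvanishing (K : fieldType)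
    (K_infinite : infinite_type K) (n d : nat) (p : {mpoly K[n * d]})
    (V0 : 'M[K]_(n, d)) :
  toeplitz V0 -> mx_eval p V0 != 0 ->
  generic_toeplitz (fun V : 'M[K]_(n, d) => mx_eval p V != 0).
Proof.
move=> tV0 pV0; exists (fun V => toeplitz V /\ mx_eval p V != 0).
split; last by move=> V [].
  exists (fun q => q = p) => V; split=> [[tV pV]|[tV [q -> pV]]] //.
  by split=> //; exists p.
move=> W [S WE] [V1 /WE[tV1 [q Sq qV1]]].
have tD : toeplitz (V1 - V0).
  by rewrite -scaleN1r; apply: toeplitz_line.
have [P PE] := mx_eval_line p V0 (V1 - V0).
have [Q QE] := mx_eval_line q V0 (V1 - V0).
have P0 : P != 0.
  by apply: contraNneq pV0 => P0; rewrite -[V0]addr0 -(scale0r (V1 - V0))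
    -PE P0 horner0.
have Q0 : Q != 0.
  by apply: contraNneq qV1 => Q0; rewrite -[V1](subrKC V0)
    -[V1 - V0]scale1r -QE Q0 horner0.
have [x] := infinite_nonroot K_infinite (mulf_neq0 P0 Q0).
rewrite hornerM mulf_eq0 negb_or PE QE => /andP[px qx].
have tx : toeplitz (V0 + x *: (V1 - V0)) by apply: toeplitz_line.
by exists (V0 + x *: (V1 - V0)); split=> //; apply/WE; split=> //; exists q.
Qed.

Lemma toeplitz_openI (K : fieldType) (n d : nat) (U U' : 'M[K]_(n, d) -> Prop) :
  toeplitz_open U -> toeplitz_open U' -> toeplitz_open (fun V => U V /\ U' V).
Proof.
move=> [S SE] [S' SE'].
exists (fun r => exists p q, [/\ S p, S' q & r = p * q]) => V; split.
  move=> [/SE[tV [p Sp pV]] /SE'[_ [q Sq qV]]]; split=> //.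
  by exists (p * q); [exists p, q | rewrite mx_evalM mulf_neq0].
move=> [tV [_ [p [q [Sp Sq ->]]]]].
rewrite mx_evalM mulf_eq0 negb_or => /andP[pV qV].
by split; [apply/SE; split=> //; exists p | apply/SE'; split=> //; exists q].
Qed.

Lemma generic_toeplitzI (K : fieldType) (n d : nat)
    (P Q : 'M[K]_(n, d) -> Prop) :
  generic_toeplitz P -> generic_toeplitz Q ->
  generic_toeplitz (fun V => P V /\ Q V).
Proof.
move=> [U [oU dU UP]] [U' [oU' dU' UQ]].
exists (fun V => U V /\ U' V); split; first exact: toeplitz_openI.
  move=> W oW neW; have neUW := dU' W oW neW.
  have [V [UV [U'V WV]]] := dU _ (toeplitz_openI oU' oW) neUW.
  by exists V.
by move=> V [/UP PV /UQ].
Qed.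

Lemma generic_toeplitz_impl (K : fieldType) (n d : nat)
    (P Q : 'M[K]_(n, d) -> Prop) :
  generic_toeplitz P -> (forall V, toeplitz V -> P V -> Q V) ->
  generic_toeplitz Q.
Proof.
move=> [U [oU dU UP]] PQ; exists U; split=> // V UV; apply: PQ (UP _ UV).
by have [S SE] := oU; have [] := (SE V).1 UV.
Qed.

(** * Moment functionals and Hankel matrices *)

(** The value at p of the linear functional that maps 'X^k to a k. *)
Definition moment (K : fieldType) (a : nat -> K) (p : {poly K}) : K :=
  \sum_(k < size p) a k * p`_k.

Definition moment_vec (K : fieldType) (m : nat) (a : nat -> K) (p : {poly K}) :
  'cV[K]_m := \col_i moment a (p * 'X^i).

Definition hankel (K : fieldType) (m e : nat) (a : nat -> K) : 'M[K]_(m, e) :=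
  \matrix_(i, k) a (i + k)%N.

Lemma moment_widen (K : fieldType) (a : nat -> K) (p : {poly K}) N :
  (size p <= N)%N -> moment a p = \sum_(k < N) a k * p`_k.
Proof.
move=> szp; rewrite /moment (big_ord_widen _ (fun k => a k * p`_k) szp).
rewrite big_mkcond; apply: eq_bigr => k _; case: ltnP => // /(nth_default 0) ->.
by rewrite mulr0.
Qed.

Lemma momentB (K : fieldType) (a : nat -> K) (p q : {poly K}) :
  moment a (p - q) = moment a p - moment a q.
Proof.
have szD := size_polyD p (- q); rewrite size_polyN in szD.
rewrite (moment_widen _ szD) (moment_widen _ (leq_maxl (size p) (size q))).
rewrite (moment_widen _ (leq_maxr (size p) (size q))) -sumrB.
by apply: eq_bigr => k _; rewrite coefB mulrBr.
Qed.

Lemma moment_vecB (K : fieldType) m (a : nat -> K) (p q : {poly K}) :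
  moment_vec m a (p - q) = moment_vec m a p - moment_vec m a q.
Proof. by apply/colP => i; rewrite !mxE mulrBl momentB. Qed.

Lemma moment_vecE (K : fieldType) m e (a : nat -> K) (p : {poly K}) :
  (size p <= e)%N ->
  moment_vec m a p = hankel m e a *m (poly_rV p : 'rV_e)^T.
Proof.
move=> szp; apply/colP => i; rewrite !mxE (@moment_widen _ _ _ (i + e)).
  rewrite big_split_ord /= big1 ?add0r => [|k _].
    apply: eq_bigr => k _; rewrite !mxE coefMXn ifN ?addKn //.
    by rewrite -leqNgt leq_addr.
  by rewrite coefMXn ltn_ord mulr0.
have [->|p0] := eqVneq p 0; first by rewrite mul0r size_poly0.
by rewrite size_mulXn // leq_add2l.
Qed.

(** The diagonals of a Toeplitz matrix are numbered from the top right corner,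
    so that its columns in reverse order form a Hankel matrix. Every diagonal
    value is picked among the entries, so it is a coordinate function of V even
    when V is not Toeplitz. *)
Definition diagonals (K : fieldType) (n d : nat) (V : 'M[K]_(n, d)) (k : nat) :
  K :=
  if [pick ij : 'I_n * 'I_d | (ij.1 + rev_ord ij.2 == k)%N] is Some ij
  then V ij.1 ij.2 else 0.

Definition diagonals_mpoly (K : fieldType) (n d : nat) (k : nat) :
  {mpoly K[n * d]} :=
  if [pick ij : 'I_n * 'I_d | (ij.1 + rev_ord ij.2 == k)%N] is Some ij
  then 'X_(mxvec_index ij.1 ij.2) else 0.

Lemma mx_eval_diagonals (K : fieldType) (n d : nat) (V : 'M[K]_(n, d)) k :
  mx_eval (diagonals_mpoly K n d k) V = diagonals V k.
Proof.
rewrite /diagonals_mpoly /diagonals; case: pickP => [ij _|_].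
  exact: mx_evalX.
exact: meval0.
Qed.

Lemma diagonalsE (K : fieldType) (n d : nat) (V : 'M[K]_(n, d))
    (i : 'I_n) (j : 'I_d) :
  toeplitz V -> diagonals V (i + rev_ord j) = V i j.
Proof.
move=> tV; rewrite /diagonals; case: pickP => [[i' j'] /= /eqP ij|].
  by apply: tV; have := ltn_ord j; have := ltn_ord j'; lia.
by move=> /(_ (i, j)); rewrite eqxx.
Qed.

Definition toeplitz_of (K : fieldType) (n d : nat) (a : nat -> K) :
  'M[K]_(n, d) := \matrix_(i, j) a (i + rev_ord j)%N.

Lemma toeplitz_of_toeplitz (K : fieldType) (n d : nat) (a : nat -> K) :
  toeplitz (toeplitz_of n d a).
Proof.
move=> i i' j j' ij; rewrite !mxE; congr (a _) => /=.
by have := ltn_ord j; have := ltn_ord j'; lia.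
Qed.

Lemma diagonals_toeplitz_of (K : fieldType) (n d : nat) (a : nat -> K) k :
  (0 < n)%N -> (0 < d)%N -> (k.+1 < n + d)%N ->
  diagonals (toeplitz_of n d a) k = a k.
Proof.
move=> n0 d0 kL; rewrite /diagonals; case: pickP => [[i j] /= /eqP <-|].
  by rewrite mxE.
have ilt : (k - d.-1 < n)%N by lia.
have jlt : (d.-1 - k < d)%N by lia.
move=> /(_ (Ordinal ilt, Ordinal jlt)) /= /negbT /eqP; case; lia.
Qed.

(** The reversal of x compensates the one of the columns in [diagonals]. *)
Lemma toeplitz_mulmx (K : fieldType) (n d : nat) (V : 'M[K]_(n, d))
    (x : 'cV[K]_d) : toeplitz V ->
  V *m x = moment_vec n (diagonals V) (rVpoly (\row_k x (rev_ord k) 0)).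
Proof.
move=> tV; rewrite (@moment_vecE _ _ d) ?size_poly //.
apply/colP => i; rewrite !mxE (reindex_inj rev_ord_inj); apply: eq_bigr => k _.
by rewrite rVpolyK !mxE -(diagonalsE i (rev_ord k) tV) rev_ordK.
Qed.

Lemma colspaceP (K : fieldType) (n d : nat) (V : 'M[K]_(n, d)) (v : 'cV_n) :
  v \in colspace V <-> exists x : 'cV_d, v = V *m x.
Proof.
split=> [vV|[x ->]].
  pose f := linfun (mulmx V : 'cV_d -> 'cV_n).
  have /subvP/(_ _ vV)/memv_imgP[x _ ->] : (colspace V <= f @: fullv)%VS.
    apply/span_subvP => _ /mapP[j _ ->].
    by rewrite colE -[V *m _]/(mulmx V _) -(lfunE (mulmx V)) memv_img ?memvf.
  by exists x; rewrite lfunE.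
have -> : V *m x = \sum_j x j 0 *: col j V.
  apply/colP => i; rewrite summxE mxE; apply: eq_bigr => j _.
  by rewrite !mxE mulrC.
apply: memv_suml => j _; apply/memvZ/memv_span/mapP.
by exists j; rewrite ?mem_enum.
Qed.

Lemma toeplitz_colspaceP (K : fieldType) (n d : nat) (V : 'M[K]_(n, d)) v :
  toeplitz V ->
  v \in colspace V <->
  exists2 p : {poly K}, (size p <= d)%N & v = moment_vec n (diagonals V) p.
Proof.
move=> tV; split=> [/colspaceP[x ->]|[p szp ->]].
  by rewrite toeplitz_mulmx //; eexists; last reflexivity; exact: size_poly.
apply/colspaceP; exists (\col_j p`_(rev_ord j)); rewrite toeplitz_mulmx //.
congr moment_vec; rewrite -[LHS](poly_rV_K szp); congr rVpoly.
by apply/rowP => k; rewrite !mxE rev_ordK.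
Qed.

Lemma toeplitz_USP (K : fieldType) (n d : nat) (V : 'M[K]_(n, d)) (s : 'S_n) :
  toeplitz V ->
  let mu := moment_vec n (diagonals V) in
  USP (colspace V) s <->
  forall p q : {poly K}, (size p <= d)%N -> (size q <= d)%N ->
    mu q = coord_perm s (mu p) -> mu q = mu p.
Proof.
move=> tV mu; split=> [usp p q szp szq|usp v1 v2].
  by apply: usp; apply/toeplitz_colspaceP => //; [exists q | exists p].
by move=> /toeplitz_colspaceP[//|q szq ->] /toeplitz_colspaceP[//|p szp ->];
  apply: usp.
Qed.

(** * Generic independence of moment vectors *)

(** A square Vandermonde matrix with m distinct nodes is invertible, so its
    product with B keeps the rank e, and e of the columns of the product form
    an invertible matrix: their nodes are the entries of z. *)
Lemma exists_Vandermonde_unit (K : fieldType) (K_infinite : infinite_type K)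
    (m e : nat) (B : 'M[K]_(e, m)) : \rank B = e ->
  exists2 z : 'rV[K]_e, B *m Vandermonde m z \in unitmx &
    injective (z 0).
Proof.
move=> rkB; have [u uu szu] := infinite_uniq_seq K_infinite m.
pose y : 'rV_m := \row_i u`_i.
have yinj i j : y 0 i = y 0 j -> i = j.
  move=> /eqP; rewrite !mxE nth_uniq ?szu // => /eqP; exact: val_inj.
have Yunit : Vandermonde m y \in unitmx.
  rewrite unitmxE det_Vandermonde unitfE; apply/prodf_neq0 => i _.
  apply/prodf_neq0 => j ij; rewrite subr_eq0; apply: contraTneq ij => /yinj ->.
  by rewrite ltnn.
have fullBY : row_full (B *m Vandermonde m y)^T.
  by rewrite /row_full mxrank_tr mxrankMfree ?rkB // row_free_unit.
exists (\row_k y 0 (fullrankfun fullBY k)) => [|i j]; last first.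
  move=> zij; apply: (@fullrankfun_inj _ _ _ _ fullBY); apply: yinj.
  by move: zij; rewrite !mxE.
rewrite -unitmx_tr; have := fullrowsub_unit fullBY; congr (_ \in unitmx).
apply/matrixP => i j; rewrite !mxE; apply: eq_bigr => k _.
by rewrite !mxE.
Qed.

(** The Hankel matrix of a sum of geometric sequences k |-> z_l ^+ k is
    a product of two Vandermonde matrices with nodes z; the one on the right is
    square. *)
Lemma exists_hankel_unit (K : fieldType) (K_infinite : infinite_type K)
    (m e : nat) (B : 'M[K]_(e, m)) : \rank B = e ->
  exists a : nat -> K, B *m hankel m e a \in unitmx.
Proof.
move=> rkB; have [z Bz zinj] := exists_Vandermonde_unit K_infinite rkB.
exists (fun k => \sum_l z 0 l ^+ k).
have -> : hankel m e (fun k => \sum_l z 0 l ^+ k) =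
    Vandermonde m z *m (Vandermonde e z)^T.
  apply/matrixP => i k; rewrite !mxE; apply: eq_bigr => l _.
  by rewrite !mxE exprD.
rewrite mulmxA unitmx_mul Bz unitmx_tr unitmxE det_Vandermonde unitfE.
apply/prodf_neq0 => i _; apply/prodf_neq0 => j ij.
by rewrite subr_eq0; apply: contraTneq ij => /zinj ->; rewrite ltnn.
Qed.

(** With m + e = n + d, the entries of an m x e Hankel matrix involve
    n + d - 1 consecutive terms, which is the number of diagonals of an n x d
    matrix: every such Hankel matrix comes from a Toeplitz one. *)
Lemma generic_hankel_unit (K : fieldType) (K_infinite : infinite_type K)
    (n d m e : nat) (B : 'M[K]_(e, m)) :
  (0 < n)%N -> (0 < d)%N -> (m + e = n + d)%N -> \rank B = e ->
  generic_toeplitz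
    (fun V : 'M[K]_(n, d) => B *m hankel m e (diagonals V) \in unitmx).
Proof.
move=> n0 d0 me rkB; have [a aunit] := exists_hankel_unit K_infinite rkB.
pose D := \det (map_mx (@mpolyC (n * d) K) B *m
  \matrix_(i < m, k < e) diagonals_mpoly K n d (i + k)).
have DE V : (mx_eval D V != 0) = (B *m hankel m e (diagonals V) \in unitmx).
  rewrite unitmxE unitfE -[mx_eval D V]/(meval _ D) -det_map_mx map_mxM.
  congr (\det (_ *m _) != 0); apply/matrixP => i k; rewrite !mxE.
    exact: mevalC.
  exact: mx_eval_diagonals.
suff DV0 : mx_eval D (toeplitz_of n d a) != 0.
  apply: generic_toeplitz_impl
    (generic_toeplitz_nonvanishing K_infinite (@toeplitz_of_toeplitz _ n d a)
       DV0) _ => V _.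
  by rewrite DE.
rewrite DE; congr (_ *m _ \in unitmx): aunit.
apply/matrixP => i k; rewrite !mxE diagonals_toeplitz_of //.
by have := ltn_ord i; have := ltn_ord k; lia.
Qed.

(** The source of all the genericity used below. It is applied to matrices of
    various shapes m x e, all built from the same diagonals. *)
Lemma generic_moment_vec_inj (K : fieldType) (K_infinite : infinite_type K)
    (n d h m e : nat) (B : 'M[K]_(h, m)) :
  (0 < n)%N -> (0 < d)%N -> (m + e = n + d)%N -> (e <= \rank B)%N ->
  generic_toeplitz (fun V : 'M[K]_(n, d) =>
    forall p : {poly K}, (size p <= e)%N ->
      B *m moment_vec m (diagonals V) p = 0 -> p = 0).
Proof.
move=> n0 d0 me rkB.
have [C CE] : exists C, row_base B = C *m B.
  by apply/submxP; rewrite eq_row_base.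
(* e independent combinations of the rows of B *)
pose B' := (pid_mx e : 'M_(e, \rank B)) *m C *m B.
have rkB' : \rank B' = e.
  by rewrite /B' -mulmxA -CE mxrankMfree ?row_base_free ?rank_pid_mx.
apply: generic_toeplitz_impl (generic_hankel_unit K_infinite n0 d0 me rkB') _.
move=> V _ Hunit p szp; rewrite (moment_vecE m _ szp) => Bp.
have: B' *m hankel m e (diagonals V) *m (poly_rV p : 'rV_e)^T = 0.
  by rewrite -!mulmxA Bp !mulmx0.
move=> /(congr1 (mulmx (invmx (B' *m hankel m e (diagonals V))))).
rewrite mulKmx // mulmx0 => /(congr1 trmx); rewrite trmxK trmx0 => p0.
by rewrite -(poly_rV_K szp) p0 linear0.
Qed.

(** * Shifted permutation matrices *)

Lemma jordan0_exp (K : fieldType) (n k : nat) (i j : 'I_n) :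
  (jordan0 K n ^+ k) i j = (nat_of_ord i == j + k)%N%:R.
Proof.
elim: k i j => [|k IHk] i j; first by rewrite expr0 mxE addn0.
rewrite exprS mxE; under eq_bigr do rewrite IHk mxE -natrM mulnb.
have [ilt|ige] := ltnP i.-1 n; last by have := ltn_ord i; lia.
rewrite (bigD1 (Ordinal ilt)) //= big1 ?addr0 => [|l /eqP li].
  by congr (_%:R); congr nat_of_bool; apply/idP/idP; lia.
case: eqP => //= ij; case: li; apply: val_inj => /=; lia.
Qed.

Lemma trmx_exp (K : fieldType) (n k : nat) (A : 'M[K]_n) :
  A^T ^+ k = (A ^+ k)^T.
Proof.
elim: k => [|k IHk]; first by rewrite !expr0 trmx1.
by rewrite exprS IHk exprSr trmx_mul.
Qed.

Definition shift_defect (K : fieldType) (n : nat) (s : 'S_n) (t : nat) :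
  'M[K]_(n - t, n) :=
  rowsub (@last_ord n t) (perm_mx s - jordan0 K n ^+ t).

Lemma shift_defectE (K : fieldType) (n : nat) (s : 'S_n) (t : nat) i j :
  shift_defect K s t i j =
  (s (last_ord i) == j)%:R - (nat_of_ord i == j)%:R.
Proof. by rewrite !mxE jordan0_exp /= addnC eqn_add2r. Qed.

Lemma mul_shift_defect (K : fieldType) (n : nat) (s : 'S_n) (t : nat)
    (v : 'cV[K]_n) (i : 'I_(n - t)) :
  (shift_defect K s t *m v) i 0 = v (s (last_ord i)) 0 - v (first_ord i) 0.
Proof.
rewrite mxE; under eq_bigr do rewrite shift_defectE mulrBl.
rewrite sumrB (bigD1 (s (last_ord i))) //= eqxx mul1r big1 ?addr0.
  rewrite (bigD1 (first_ord i)) //= eqxx mul1r big1 ?addr0 // => j.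
  by rewrite -val_eqE eq_sym /= => /negPf ->; rewrite mul0r.
by move=> j; rewrite eq_sym => /negPf ->; rewrite mul0r.
Qed.

Lemma rank_shift_defect0 (K : fieldType) (n : nat) (s : 'S_n) :
  \rank (shift_defect K s 0) = \rank (1%:M - perm_mx s : 'M[K]_n).
Proof.
rewrite -[RHS]mxrank_opp opprB /shift_defect expr0.
have n0 : n = (n - 0)%N by rewrite subn0.
apply/eqmx_rank/andP; split; first exact: rowsub_sub.
set A := perm_mx s - 1; have {1}-> : A = rowsub id A.
  by apply/matrixP => i j; rewrite [RHS]mxE.
apply: (submx_rowsub (cast_ord n0)) => i; exact: val_inj.
Qed.

(** Row i of the matrix for a negative shift is e_(s i) - e_(i + t). Permuting
    its columns by s gives e_i - e_(s^-1 (i + t)), the opposite of a row of the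
    matrix for the positive shift and the inverse permutation. *)
Lemma shift_rankN (K : fieldType) (n : nat) (s : 'S_n) (k : nat) :
  shift_rank K s (Negz k) = \rank (shift_defect K (s^-1)%g k.+1).
Proof.
rewrite /= -(mxrankMfree _ (B := perm_mx s^-1)); last first.
  by rewrite row_free_unit unitmx_perm.
rewrite -[RHS]mxrank_opp -col_permE; congr (\rank _).
apply/matrixP => i j; rewrite [RHS]mxE shift_defectE opprB !mxE trmx_exp mxE.
rewrite jordan0_exp /= (inj_eq perm_inj) -(can_eq (permK s)) permKV.
by congr (_%:R - _%:R); rewrite -val_eqE //= eq_sym addnC.
Qed.

Lemma USP_inv (K : fieldType) (n : nat) (W : {vspace 'cV[K]_n}) (s : 'S_n) :
  USP W s^-1 <-> USP W s.
Proof.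
have USPV (u : 'S_n) : USP W u -> USP W u^-1.
  move=> usp v w vW wW vw; apply/esym/usp => //.
  by rewrite vw /coord_perm -row_permM mulgV row_perm1.
by split=> [/USPV|/USPV//]; rewrite invgK.
Qed.

(** * The coincidences between a column space and its permuted copy *)

(** The cokernel of Q, encoded by [kermx Q], has dimension at least d + t, the
    size bound of q * 'X^t - p, whose moment vector lies in the image of Q. *)
Lemma generic_USP_shift (K : fieldType) (K_infinite : infinite_type K)
    (n d t : nat) (s : 'S_n) :
  (0 < d)%N -> (\rank (shift_defect K s t) + 2 * t + d <= n)%N ->
  generic_toeplitz (fun V : 'M[K]_(n, d) =>
    forall p q : {poly K}, (size p <= d)%N -> (size q <= d)%N ->
      moment_vec n (diagonals V) q =
        coord_perm s (moment_vec n (diagonals V) p) ->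
      p = q * 'X^t).
Proof.
move=> d0 rkle; set Q := shift_defect K s t in rkle *.
have n0 : (0 < n)%N by lia.
have me : ((n - t) + (d + t) = n + d)%N by lia.
have rkker : (d + t <= \rank (kermx Q))%N by rewrite mxrank_ker; lia.
apply: generic_toeplitz_impl
  (generic_moment_vec_inj K_infinite n0 d0 me rkker) _ => V _ inj p q szp szq.
move=> /colP qp; apply/esym/eqP; rewrite -subr_eq0; apply/eqP/inj.
  have szN : (size (q * 'X^t - p)%R <= maxn (size (q * 'X^t)%R) (size p))%N.
    by rewrite -(size_polyN p) size_polyD.
  apply: leq_trans szN _; rewrite geq_max (leq_trans szp) ?leq_addr // andbT.
  have [->|q0] := eqVneq q 0; first by rewrite mul0r size_poly0.
  by rewrite size_mulXn // addnC leq_add2r.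
set mu := moment_vec _ _ _.
have -> : mu = Q *m moment_vec n (diagonals V) p.
  apply/colP => i; rewrite mul_shift_defect; have := qp (last_ord i).
  rewrite [RHS]mxE => <-; rewrite !mxE -momentB; congr moment.
  by rewrite mulrBl -mulrA -exprD.
by rewrite mulmxA mulmx_ker mul0mx.
Qed.

(** The coincidence between q and q * 'X^t, as a linear system on the moment
    vector of length t + n of q. Its first t entries are the moments that
    occur only in the rows < t of the coincidence, with coefficient 1; the next
    n ones form the moment vector of q * 'X^t, and the rows >= t of the
    coincidence say that [shift_defect] kills it. *)
Definition recurrence_mx (K : fieldType) (n t : nat) (tn : (t <= n)%N)
  (s : 'S_n) : 'M[K]_(t + (n - t), t + n) :=
  block_mx 1%:M (- rowsub (widen_ord tn) (perm_mx s)) 0 (shift_defect K s t).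

Lemma rank_recurrence_mx (K : fieldType) (n t : nat) (tn : (t <= n)%N)
    (s : 'S_n) :
  \rank (recurrence_mx K tn s) = (t + \rank (shift_defect K s t))%N.
Proof.
set P : 'M[K]_(t, n) := - rowsub (widen_ord tn) (perm_mx s).
have -> : recurrence_mx K tn s =
    block_mx 1%:M 0 0 (shift_defect K s t) *m block_mx 1%:M P 0 1%:M.
  by rewrite mulmx_block !mul1mx !mul0mx !mulmx0 mulmx1 !addr0 !add0r.
rewrite mxrankMfree ?rank_diag_block_mx ?mxrank1 //.
by rewrite row_free_unit unitmxE det_ublock !det1 mulr1 unitr1.
Qed.

Lemma recurrence_mxP (K : fieldType) (n t : nat) (tn : (t <= n)%N)
    (s : 'S_n) (a : nat -> K) (p : {poly K}) :
  recurrence_mx K tn s *m moment_vec (t + n) a p = 0 <->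
  moment_vec n a p = coord_perm s (moment_vec n a (p * 'X^t)).
Proof.
set w := moment_vec n a (p * 'X^t).
have -> : moment_vec (t + n) a p = col_mx (moment_vec t a p) w.
  apply/colP => i; rewrite !mxE; case: split_ordP => j -> //.
    by rewrite mxE.
  by rewrite mxE -mulrA -exprD.
rewrite mul_block_col mul1mx mul0mx add0r mulNmx mul_rowsub_mx.
rewrite mul_perm_mx_cV.
have low (i : 'I_(n - t)) :
    w (first_ord i) 0 = moment_vec n a p (last_ord i) 0.
  by rewrite !mxE -mulrA -exprD.
split=> [/eqP|/colP E].
  rewrite col_mx_eq0 => /andP[/eqP top /eqP bot]; apply/colP => i.
  have [it|ti] := ltnP i t.
    have /colP/(_ (Ordinal it)) := top; rewrite !mxE /= => /eqP.
    rewrite subr_eq0 => /eqP ->; congr (moment _ _).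
    by congr (_ * 'X^(s _)); apply: val_inj.
  have ilt : (i - t < n - t)%N by rewrite ltn_sub2r // (leq_ltn_trans ti).
  have /colP/(_ (Ordinal ilt)) := bot; rewrite mul_shift_defect low [RHS]mxE.
  have -> : last_ord (Ordinal ilt) = i by apply: val_inj; rewrite /= subnKC.
  by move=> /eqP; rewrite subr_eq0 => /eqP wE; rewrite [RHS]mxE.
apply/eqP; rewrite col_mx_eq0; apply/andP; split; apply/eqP/colP => i.
  have := E (widen_ord tn i); rewrite !mxE /= => ->; exact: subrr.
by rewrite mul_shift_defect low E !mxE subrr.
Qed.

Lemma exists_moment_vec_kernel (K : fieldType) (h m e : nat)
    (B : 'M[K]_(h, m)) (a : nat -> K) :
  (\rank B < e)%N ->
  exists p : {poly K}, [/\ p != 0, (size p <= e)%N & B *m moment_vec m a p = 0].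
Proof.
move=> rkB; have : ~~ row_free (B *m hankel m e a)^T.
  rewrite /row_free mxrank_tr neq_ltn.
  by rewrite (leq_ltn_trans _ rkB) ?mxrankM_maxl.
rewrite -kermx_eq0 => /rowV0Pn[v /sub_kermxP vB v0].
exists (rVpoly v); rewrite size_poly; split=> //.
  by apply: contra_neq v0 => p0; rewrite -[v]rVpolyK p0 linear0.
rewrite (@moment_vecE _ _ e) ?size_poly // rVpolyK mulmxA.
by apply: trmx_inj; rewrite trmx_mul trmxK vB trmx0.
Qed.

Lemma generic_USP_iff (K : fieldType) (K_infinite : infinite_type K)
    (n d t : nat) (s : 'S_n) :
  (0 < t)%N -> (2 * t <= d)%N -> (2 * d <= n)%N ->
  (\rank (shift_defect K s t) <= d - 2 * t)%N ->
  generic_toeplitz (fun V : 'M[K]_(n, d) =>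
    USP (colspace V) s <-> \rank (shift_defect K s t) = (d - 2 * t)%N).
Proof.
move=> t0 td dn.
have [d0 n0 tn] : [/\ (0 < d)%N, (0 < n)%N & (t <= n)%N] by split; lia.
rewrite leq_eqVlt => /orP[/eqP rkQ|rkQ].
  (* The property holds: the system on q has full rank t + (d - 2 t) = d - t,
     the number of coefficients of q. *)
  have rkle : (\rank (shift_defect K s t) + 2 * t + d <= n)%N by lia.
  have me : ((t + n) + (d - t) = n + d)%N by lia.
  have rkB : (d - t <= \rank (recurrence_mx K tn s))%N.
    by rewrite rank_recurrence_mx; lia.
  apply: generic_toeplitz_impl (generic_toeplitzI
    (generic_USP_shift K_infinite d0 rkle)
    (generic_moment_vec_inj K_infinite n0 d0 me rkB)) _ => V tV [shift inj].
  split=> // _; apply/(toeplitz_USP s tV) => p q szp szq qp.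
  have pE := shift p q szp szq qp.
  suff q0 : q = 0 by rewrite pE q0 mul0r.
  apply: inj; last by apply/recurrence_mxP; rewrite -pE.
  have [->|q0] := eqVneq q 0; first by rewrite size_poly0.
  by move: szp; rewrite pE size_mulXn //; lia.
(* The property fails: a nonzero solution q of the system yields a coincidence,
   and injectivity of V forbids q and q * 'X^t to have equal moments. *)
have rk1 : (d <= \rank (1%:M : 'M[K]_n))%N by rewrite mxrank1; lia.
apply: generic_toeplitz_impl
  (generic_moment_vec_inj K_infinite n0 d0 erefl rk1) _ => V tV inj.
split=> [usp|]; last by lia.
have rkB : (\rank (recurrence_mx K tn s) < d - t)%N.
  by rewrite rank_recurrence_mx; lia.
have [q [q0 szq /recurrence_mxP qE]] :=
  exists_moment_vec_kernel (diagonals V) rkB.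
have szp : (size (q * 'X^t)%R <= d)%N by rewrite size_mulXn //; lia.
have szq' : (size q <= d)%N by lia.
have /eqP := (toeplitz_USP s tV).1 usp _ _ szp szq' qE.
rewrite -subr_eq0 -moment_vecB -[moment_vec _ _ _]mul1mx => /eqP/inj.
have szD : (size (q - q * 'X^t)%R <= d)%N.
  apply: leq_trans (size_polyD _ _) _.
  by rewrite size_polyN geq_max szq' szp.
move=> /(_ szD)/eqP; rewrite subr_eq0.
move=> /eqP/(congr1 (fun r : {poly K} => size r)).
by rewrite size_mulXn //; lia.
Qed.

Theorem theorem4 (K : fieldType) (K_infinite : infinite_type K)
    (d n : nat) (d_ge1 : (1 <= d)%N) (n_ge2d : (2 * d <= n)%N) (s : 'S_n) :
  ((\rank (1%:M - perm_mx s : 'M[K]_n)%R <= d)%N ->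
     generic_toeplitz (fun V : 'M[K]_(n, d) => USP (colspace V) s))
  /\
  ((d < \rank (1%:M - perm_mx s : 'M[K]_n)%R)%N ->
     forall t : int, (2 * `|t| <= d)%N ->
       (shift_rank K s t <= d - 2 * `|t|)%N ->
       generic_toeplitz (fun V : 'M[K]_(n, d) =>
         USP (colspace V) s <-> shift_rank K s t = (d - 2 * `|t|)%N)).
Proof.
split=> [rk0|rk0 [[|k]|k]].
- have rkle : (\rank (shift_defect K s 0) + 2 * 0 + d <= n)%N.
    by rewrite rank_shift_defect0; lia.
  apply: generic_toeplitz_impl
    (generic_USP_shift K_infinite d_ge1 rkle) _ => V tV shift.
  apply/(toeplitz_USP s tV) => p q szp szq /(shift p q szp szq) ->.
  by rewrite mulr1.
(* For t = 0 the assumptions on the ranks contradict each other. *)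
- move=> _; rewrite -[shift_rank K s 0]/(\rank (shift_defect K s 0)).
  by rewrite rank_shift_defect0 /= muln0 subn0 leqNgt rk0.
- by move=> td rkt; apply: generic_USP_iff.
rewrite shift_rankN => td rkt.
apply: generic_toeplitz_impl
  (generic_USP_iff K_infinite _ _ n_ge2d rkt) _ => // V _.
by rewrite USP_inv.
Qed.
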